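(* Let $n,m$ be natural numbers with $m\le n$, $P$ a predicate on families, and $Q$ a predicate on pairs (family, set) that incrementally checks $P$ and is preserved by injective functions. Let $[l_0,\ldots,l_m]$ be a list of natural numbers and let $\mathcal{F}_b\subseteq\mathcal{L}([l_0,\ldots,l_m],n,P)$ be a subcollection that iso-represents $\mathcal{L}([l_0,\ldots,l_m],n,P)$. Then $$\mathcal{F}_b'=\bigcup_{A\in\mathcal{S}(n,m)}\{F\cup\{A\}: F\in\mathcal{F}_b,\ A\notin F,\ Q\,F\,A\}$$ is a subcollection of $\mathcal{L}([l_0,\ldots,l_{m-1},l_m+1],n,P)$ that iso-represents $\mathcal{L}([l_0,\ldots,l_{m-1},l_m+1],n,P)$.
   Context: All sets and families are finite; sets are sets of natural numbers and $[n]=\{0,1,\ldots,n-1\}$. A family $F$ is over $[n]$ if $\bigcup F\subseteq[n]$. For a list $L=[l_0,\ldots,l_m]$, a family $F$ is $L$-partitioned if every $A\in F$ has $|A|\le m$ and, for each $0\le i\le m$, exactly $l_i$ members of $F$ have exactly $i$ elements. $\mathcal{L}(L,n,P)$ denotes the collection of all $L$-partitioned families over $[n]$ satisfying $P$. $\mathcal{S}(n,m)$ is the collection of all $A\subseteq[n]$ with $|A|=m$. $Q$ incrementally checks $P$ if for every family $F$ and set $A$ with $|A|\ge|A'|$ for all $A'\in F$ and $A\notin F$: $P(F\cup\{A\})\iff(P(F)\text{ and }Q\,F\,A)$. $Q$ is preserved by injective functions if for every family $F$, set $A$ and function $f$ injective on $\bigcup F\cup A$, $Q\,F\,A$ implies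 $Q\,\{f[B]:B\in F\}\,f[A]$, where $f[B]$ is the image of $B$. Two families $F,F'$ are isomorphic if there is a bijection $f:\bigcup F\to\bigcup F'$ with $\{f[B]:B\in F\}=F'$. A collection $\mathcal{F}_b$ iso-represents a collection $\mathcal{F}$ if every $F\in\mathcal{F}$ is isomorphic to some $F_b\in\mathcal{F}_b$. *)

(* Defs.v *)
From mathcomp Require Import all_boot finmap.
From mathcomp Require Import boolp classical_sets functions.

Set Implicit Arguments.
Unset Strict Implicit.
Unset Printing Implicit Defensive.

Local Open Scope fset_scope.

(* Sets of naturals and families of such sets are finite ([{fset _}]);
   a collection of families is a classical set of families. *)
Notation natset := {fset nat}.
Notation setfam := {fset {fset nat}}.
Notation collection := (set setfam).

Definition initial (n : nat) : natset := [fset i | i in iota 0 n].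

Definition family_over (n : nat) (F : setfam) : Prop := fcover F `<=` initial n.

(* For L = [l_0, ..., l_m], [size L] is m + 1, so that [#|` A| < size L] reads
   |A| <= m. *)
Definition partitioned (L : seq nat) (F : setfam) : Prop :=
  (forall A, A \in F -> (#|` A| < size L)%N) /\
  (forall i, (i < size L)%N -> #|` [fset A in F | #|` A| == i]| = nth 0 L i).

Definition Lfam (L : seq nat) (n : nat) (P : setfam -> Prop) : collection :=
  [set F | [/\ partitioned L F, family_over n F & P F]]%classic.

Definition Ssets (n m : nat) : set natset :=
  [set A : natset | (A `<=` initial n)%fset /\ #|` A| = m]%classic.

Definition incrementally_checks
    (Q : setfam -> natset -> Prop) (P : setfam -> Prop) : Prop :=
  forall (F : setfam) (A : natset),
    (forall A', A' \in F -> (#|` A'| <= #|` A|)%N) -> A \notin F ->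
    (P (F `|` [fset A]) <-> P F /\ Q F A).

Definition family_image (f : nat -> nat) (F : setfam) : setfam :=
  [fset f @` B | B : natset in F].

(* Only the values of [f] on the union of F and A matter here: a function
   defined on that finite set alone is extended arbitrarily to [nat]. *)
Definition preserved_by_injective (Q : setfam -> natset -> Prop) : Prop :=
  forall (F : setfam) (A : natset) (f : nat -> nat),
    {in fcover F `|` A &, injective f} ->
    Q F A -> Q (family_image f F) (f @` A).

Definition isomorphic (F F' : setfam) : Prop :=
  exists f : nat -> nat,
    set_bij [set` fcover F]%classic [set` fcover F']%classic f /\
    family_image f F = F'.

Definition iso_represents (Fb Fs : collection) : Prop :=
  forall F, Fs F -> exists2 F0, Fb F0 & isomorphic F F0.

(* Main.v *)
(* The heart is iso-representation. A family G counted by [l_0, ..., l_m + 1]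
   has a member A with m elements; removing it gives a family F that is carried
   by some bijection f onto a member F0 of F_b. Since F and F0 have equally large
   unions inside [n], f extends to an injection g of the union of G into [n], and
   g carries G to F0 plus g[A], with Q F0 g[A] by invariance of Q. *)
Require Import Defs.
From mathcomp Require Import all_boot finmap.
From mathcomp Require Import boolp classical_sets functions.

Set Implicit Arguments.
Unset Strict Implicit.
Unset Printing Implicit Defensive.

Local Open Scope fset_scope.

(** Injectivity of [f] on [X] gives |f[X]| = |X|, so Z \ f[X] has at least as many points as Y \ X.
    Points of Y \ X are then sent to points of Z \ f[X] by their rank in the enumerations of these
    two sets. *)
Lemma injective_extension (T U : choiceType) (f : T -> U)
    (X Y : {fset T}) (Z : {fset U}) :
  {in X &, injective f} -> f @` X `<=` Z -> X `<=` Y -> #|` Y| <= #|` Z| ->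
  exists g : T -> U,
    [/\ {in X, g =1 f}, {in Y &, injective g} & g @` Y `<=` Z].
Proof.
move=> f_inj fXZ XY leYZ; set s := Z `\` f @` X; set r := Y `\` X.
have le_rs : size r <= size s.
  by rewrite !cardfsDS // card_in_imfset //= leq_sub2r.
have idx x : x \in Y -> x \notin X -> index x r < size s.
  by move=> xY xX; apply: leq_trans le_rs; rewrite index_mem !inE xX xY.
(* On [Y] the default [f x] is never returned, by [idx]; it only provides some element of [U], which
   might otherwise be empty. *)
pose g x := if x \in X then f x else nth (f x) s (index x r).
have gX x : x \in X -> g x = f x by rewrite /g => ->.
have gYX x : x \in Y -> x \notin X -> g x \in s.
  by move=> xY xX; rewrite /g (negPf xX) mem_nth ?idx.
have gXYX x y : x \in X -> y \in Y -> y \notin X -> g x <> g y.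
  move=> xX yY yX gxy; have := gYX y yY yX.
  by rewrite -gxy gX // inE in_imfset.
exists g; split=> // [x y xY yY|].
  have [xX|xX] := boolP (x \in X); have [yX|yX] := boolP (y \in X).
  - by rewrite !gX //; apply: f_inj.
  - by move/gXYX; case.
  - by move/esym/gXYX; case.
  rewrite /g (negPf xX) (negPf yX) (set_nth_default (f x) (f y)) ?idx //.
  move/eqP; rewrite nth_uniq ?idx ?fset_uniq // => /eqP.
  by apply: (index_inj x); rewrite !inE ?xX ?yX.
apply/fsubsetP=> _ /imfsetP[x /= xY ->].
have [xX|xX] := boolP (x \in X); first by rewrite gX // (fsubsetP fXZ) ?in_imfset.
by have := gYX x xY xX; rewrite inE => /andP[].
Qed.

Lemma mem_fcoverP (T : choiceType) (F : {fset {fset T}}) (x : T) :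
  reflect (exists2 B, B \in F & x \in B) (x \in fcover F).
Proof.
apply: (iffP (bigfcupP _ _ _ _)) => [[B /andP[BF _] xB]|[B BF xB]]; exists B => //.
by rewrite BF.
Qed.

Lemma fsub_fcover (T : choiceType) (F : {fset {fset T}}) (B : {fset T}) :
  B \in F -> B `<=` fcover F.
Proof. by move=> BF; apply/fsubsetP=> x xB; apply/mem_fcoverP; exists B. Qed.

Lemma fcoverU1 (T : choiceType) (F : {fset {fset T}}) (A : {fset T}) :
  fcover (F `|` [fset A]) = fcover F `|` A.
Proof.
apply/fsetP=> x; rewrite inE; apply/mem_fcoverP/orP => [[B]|[/mem_fcoverP[B BF xB]|xA]].
- rewrite !inE => /orP[BF|/eqP->] xB; last by right.
  by left; apply/mem_fcoverP; exists B.
- by exists B; rewrite // !inE BF.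
- by exists A; rewrite // !inE eqxx orbT.
Qed.

Lemma imfset_inj_in (T U : choiceType) (f : T -> U) (X A B : {fset T}) :
  {in X &, injective f} -> A `<=` X -> B `<=` X -> f @` A = f @` B -> A = B.
Proof.
move=> f_inj.
have sub C D : C `<=` X -> D `<=` X -> f @` C = f @` D -> C `<=` D.
  move=> CX DX eCD; apply/fsubsetP=> x xC.
  have : f x \in f @` D by rewrite -eCD in_imfset.
  case/imfsetP=> y /= yD /f_inj -> //; first exact: (fsubsetP CX).
  exact: (fsubsetP DX).
by move=> AX BX eAB; apply/eqP; rewrite eqEfsubset (sub A B) ?(sub B A).
Qed.

Lemma fcover_family_image (f : nat -> nat) (F : setfam) :
  fcover (family_image f F) = f @` fcover F.
Proof.
apply/fsetP=> y; apply/mem_fcoverP/imfsetP => /=.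
  case=> _ /imfsetP[B /= BF ->] /imfsetP[x /= xB ->].
  by exists x => //; apply/mem_fcoverP; exists B.
case=> x /mem_fcoverP[B BF xB] ->.
by exists (f @` B); rewrite ?in_imfset.
Qed.

Lemma family_imageU1 (f : nat -> nat) (F : setfam) (A : natset) :
  family_image f (F `|` [fset A]) = family_image f F `|` [fset f @` A].
Proof. by rewrite /family_image imfsetU imfset_fset1. Qed.

Lemma eq_in_family_image (f g : nat -> nat) (F : setfam) :
  {in fcover F, f =1 g} -> family_image f F = family_image g F.
Proof.
move=> fg; apply: eq_in_imfset => B BF; apply: eq_in_imfset => x xB.
by apply: fg; apply: (fsubsetP (fsub_fcover BF)).
Qed.

Lemma isomorphic_family_image (f : nat -> nat) (F : setfam) :
  {in fcover F &, injective f} -> isomorphic F (family_image f F).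
Proof.
move=> f_inj; exists f; split=> //; rewrite fcover_family_image; split.
- by move=> x /= xF; rewrite in_imfset.
- by move=> x y; rewrite !inE => xF yF; apply: f_inj.
- by move=> y /imfsetP[x /= xF ->]; exists x.
Qed.

Lemma isomorphic_inj (F F' : setfam) : isomorphic F F' ->
  exists2 f, {in fcover F &, injective f} & F' = family_image f F.
Proof.
case=> f [[_ f_inj _] <-]; exists f => // x y xF yF.
by apply: f_inj; rewrite inE.
Qed.

Lemma family_overU1 (n : nat) (F : setfam) (A : natset) :
  family_over n (F `|` [fset A]) <-> family_over n F /\ A `<=` initial n.
Proof. by rewrite /family_over fcoverU1 fsubUset; split=> [/andP|/andP]. Qed.

Lemma card_fset_sepU1 (T : choiceType) (p : pred T) (F : {fset T}) (A : T) :
  A \notin F ->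
  #|` [fset B in F `|` [fset A] | p B]| = (p A + #|` [fset B in F | p B]|)%N.
Proof.
move=> AF; have [pA|pA] := boolP (p A).
  have -> : [fset B in F `|` [fset A] | p B] = A |` [fset B in F | p B].
    apply/fsetP=> B; rewrite !inE; have [->|_] := eqVneq B A; last by rewrite orbF.
    by rewrite pA orbT.
  by rewrite cardfsU1 !inE (negPf AF).
congr (#|` _|); apply/fsetP=> B; rewrite !inE.
by have [->|_] := eqVneq B A; rewrite ?orbF // (negPf pA) !andbF.
Qed.

(** A set of size m respects the size bound and raises by one exactly the count at index m, which is
    the last entry of the list. *)
Lemma partitionedU1 (l : seq nat) (lm : nat) (F : setfam) (A : natset) :
  #|` A| = size l -> A \notin F ->
  partitioned (rcons l lm.+1) (F `|` [fset A]) <-> partitioned (rcons l lm) F.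
Proof.
move=> cA AF; rewrite /partitioned !size_rcons.
(* The change of the last entry is written as a 0/1 summand, the form in which [card_fset_sepU1]
   gives the change of the counts, so that it cancels. *)
have nthS i : i < (size l).+1 ->
    nth 0 (rcons l lm.+1) i = ((#|` A| == i) + nth 0 (rcons l lm) i)%N.
  rewrite cA !nth_rcons ltnS leq_eqVlt eq_sym => /orP[/eqP->|il].
    by rewrite ltnn eqxx add1n.
  by rewrite il gtn_eqF.
split=> -[small count]; split=> [B BF|i il].
- by apply: small; rewrite !inE BF.
- by apply/eqP; rewrite -(eqn_add2l (#|` A| == i)) -nthS // -count // card_fset_sepU1.
- by move: BF; rewrite !inE => /orP[/small|/eqP->] //; rewrite cA.
- by rewrite card_fset_sepU1 // count // nthS.
Qed.

(** Read from right to left this yields the inclusion of the new collection; read from left to right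
    it allows a set of size m to be removed from a family. *)
Lemma LfamU1 (P : setfam -> Prop) (Q : setfam -> natset -> Prop)
    (l : seq nat) (lm n : nat) (F : setfam) (A : natset) :
  incrementally_checks Q P -> Ssets n (size l) A -> A \notin F ->
  Lfam (rcons l lm.+1) n P (F `|` [fset A]) <-> Lfam (rcons l lm) n P F /\ Q F A.
Proof.
move=> QP [An cA] AF.
(* Being partitioned bounds all members of [F] by m = |A|, which is the size condition of the
   incremental check. *)
have PQ : partitioned (rcons l lm) F -> P (F `|` [fset A]) <-> P F /\ Q F A.
  case=> small _; apply: QP => // B /small.
  by rewrite size_rcons ltnS cA.
split=> [[/partitionedU1 partF /family_overU1[Fn _] PFA]|[[partF Fn PF] QFA]].
  by have {}partF := partF cA AF; case/PQ: PFA.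
by split; [apply/partitionedU1|apply/family_overU1|apply/PQ].
Qed.

(* [l_0, ..., l_m] is [rcons l lm], with l = [l_0, ..., l_{m-1}] and lm = l_m. *)
Theorem theorem4 (n m : nat) (hmn : (m <= n)%N)
    (P : setfam -> Prop) (Q : setfam -> natset -> Prop)
    (hQP : incrementally_checks Q P) (hQinj : preserved_by_injective Q)
    (l : seq nat) (lm : nat) (hl : size l = m)
    (Fb : collection)
    (hFb : (Fb `<=` Lfam (rcons l lm) n P)%classic)
    (hrep : iso_represents Fb (Lfam (rcons l lm) n P)) :
  let Fb' : collection :=
    (\bigcup_(A in Ssets n m)
       [set (F `|` [fset A])%fset | F in
          [set F : setfam | [/\ Fb F, A \notin F & Q F A]]])%classic in
  (Fb' `<=` Lfam (rcons l lm.+1) n P)%classic /\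
  iso_represents Fb' (Lfam (rcons l lm.+1) n P).
Proof.
subst m; split=> [_ [A SA] [F [FbF AF QFA] <-]|G LG].
  by apply/(LfamU1 lm hQP SA AF); split=> //; apply: hFb.
(* The count at index m is the successor [lm.+1], hence positive. *)
have [[_ /(_ (size l))]] := LG; rewrite size_rcons nth_rcons ltnn eqxx ltnSn => /(_ isT) cG Gn _.
have /fset0Pn[A] : [fset A in G | #|` A| == size l] != fset0.
  by rewrite -cardfs_gt0 cG.
rewrite !inE => /andP[AG /eqP cA].
have SA : Ssets n (size l) A.
  by split=> //; apply: fsubset_trans Gn; apply: fsub_fcover.
have AF : A \notin G `\ A by rewrite !inE eqxx.
have GE : (G `\ A) `|` [fset A] = G by rewrite fsetUC fsetD1K.
move: (G `\ A) AF GE => F AF GE; subst G.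
have /(LfamU1 lm hQP SA AF)[LF QFA] := LG.
have [F0 FbF0 /isomorphic_inj[f f_inj F0E]] := hrep _ LF; subst F0.
have [_ F0n _] := hFb _ FbF0.
rewrite /family_over fcover_family_image in F0n.
rewrite /family_over fcoverU1 in Gn.
(* There is room for the extension because the union of [F] and [A] itself lies in [n]. *)
have [|g [gf g_inj gn]] := injective_extension f_inj F0n (fsubsetUl _ A).
  exact: fsubset_leq_card.
have imE : family_image f F = family_image g F.
  by apply: eq_in_family_image => x /gf.
rewrite imE in FbF0.
have gA : g @` A `<=` initial n.
  by apply: fsubset_trans gn; rewrite imfsetU fsubsetUr.
exists (family_image g (F `|` [fset A])); last first.
  by apply: isomorphic_family_image; rewrite fcoverU1.
rewrite family_imageU1; exists (g @` A).
  split=> //; rewrite -cA card_in_imfset // => x y xA yA.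
  by apply: g_inj; rewrite inE ?xA ?yA orbT.
exists (family_image g F) => //; split=> //; last exact: hQinj.
(* If g[A] = g[B] with [B] in [F], injectivity on the whole union forces A = B, against the choice
   of [F]. *)
apply/negP=> /imfsetP[B /= BF eAB].
have BFA : B `<=` fcover F `|` A.
  by apply: fsubset_trans (fsubsetUl _ _); apply: fsub_fcover.
by move: AF; rewrite (imfset_inj_in g_inj (fsubsetUr _ _) BFA eAB) BF.
Qed.
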